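(* Let $A, B, C$ be integers such that $A, B, C, ABC$ are distinct square-free non-zero integers, and let $L_B = \mathbb{Q}(\sqrt{A}, \sqrt{B}, \sqrt{C})$ be the corresponding triquadratic number field. Suppose there exist non-zero rational numbers $a, b$ with $$a^2 - 1 = (B - A)\, b^2,$$ and suppose $B \neq a$. Then $\min\deg_{L_B}(\sqrt{A} + a\sqrt{B}) = 2$.
   Context: A primitive element of a number field $L$ of degree $n$ is an $\alpha \in L$ with $\mathbb{Q}(\alpha) = L$. For such $\alpha$, every $v \in L$ can be written uniquely as $v = f(\alpha)$ with $f \in \mathbb{Q}[x]$, $\deg f \leq n-1$; $\deg_\alpha(v) := \deg f$, and $\min\deg_L(v) := \min_\alpha \deg_\alpha(v)$ over all primitive elements $\alpha$ of $L$. *)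

(* Defs.v *)
From HB Require Import structures.
From mathcomp Require Import all_boot all_order all_algebra all_field.

Set Implicit Arguments.
Unset Strict Implicit.
Unset Printing Implicit Defensive.

Import Order.TTheory GRing.Theory Num.Theory.
Local Open Scope ring_scope.

Definition square_free (n : int) : Prop :=
  forall d : int, (d ^+ 2 %| n)%Z -> `|d| = 1.

Definition primitive_element (L : fieldExtType rat) (alpha : L) : Prop :=
  <<1; alpha>>%VS = {:L}%VS.

(* Fadjoin_poly 1 alpha v is the unique f over Q of degree < [L : Q] with
   f(alpha) = v when alpha is primitive, see deg_atE below.  The zero vector
   gets degree 0 here. *)
Definition deg_at (L : fieldExtType rat) (alpha v : L) : nat :=
  (size (Fadjoin_poly 1 alpha v)).-1.

(* "min deg_L(v) exists and is equal to d" *)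
Definition min_deg_is (L : fieldExtType rat) (v : L) (d : nat) : Prop :=
  (exists2 alpha : L, primitive_element alpha & deg_at alpha v = d)
  /\ (forall alpha : L, primitive_element alpha -> (d <= deg_at alpha v)%N).

Lemma adjoin_degree_primitive (L : fieldExtType rat) (alpha : L) :
  primitive_element alpha -> adjoin_degree 1%AS alpha = \dim {:L}.
Proof. by move=> pa; rewrite adjoin_degreeE pa dimv1 divn1. Qed.

Lemma deg_at_exists (L : fieldExtType rat) (alpha v : L) :
  primitive_element alpha ->
  exists2 f : {poly rat}, (size f <= \dim {:L})%N
                        & (map_poly (in_alg L) f).[alpha] = v.
Proof.
move=> pa; have /polyOver1P[f Df] := Fadjoin_polyOver 1%AS alpha v.
exists f; last by rewrite -Df Fadjoin_poly_eq // pa memvf.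
by rewrite -(size_map_poly (in_alg L)) -Df -(adjoin_degree_primitive pa)
           size_Fadjoin_poly.
Qed.

Lemma deg_atE (L : fieldExtType rat) (alpha v : L) (f : {poly rat}) :
  primitive_element alpha -> (size f <= \dim {:L})%N ->
  (map_poly (in_alg L) f).[alpha] = v -> deg_at alpha v = (size f).-1.
Proof.
move=> pa szf fv; rewrite /deg_at.
rewrite (Fadjoin_poly_unique (alg_polyOver 1%AS f) _ fv) ?size_map_poly //.
by rewrite (adjoin_degree_primitive pa).
Qed.

(* Main.v *)
Require Import Defs.
From HB Require Import structures.
From mathcomp Require Import all_boot all_order all_algebra all_field.
From mathcomp Require Import ring.

Import Order.TTheory GRing.Theory Num.Theory.
Local Open Scope ring_scope.

(** Write v = sA + a sB and K = Q(sA, sB).  A primitive element of degree 1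
    would lie in Q(v), which is contained in K, of dimension at most 4.  For
    degree 2, complete the square: some rational affine image of v has to be
    C x^2 with x in K.  The equation a^2 - 1 = (B - A) b^2 makes
    x = a + a b sA + b sB - b^2 sA sB work: the sA sB coefficient of x^2
    vanishes, and x^2 = r + c v with c = 2 b (a^2 - B b^2).  Then x sC is
    primitive, since v generates K, which contains x. *)

(** The minimal polynomial of [s] over [U] divides X^2 - s^2, whose coefficients lie in [U]. *)
Lemma dim_Fadjoin_sqr (F : fieldType) (L : fieldExtType F) (U : {subfield L})
    (s : L) : s ^+ 2 \in U -> (\dim <<U; s>> <= \dim U * 2)%N.
Proof.
move=> s2U; rewrite dim_Fadjoin mulnC leq_mul2l; apply/orP; right.
have sz : size ('X^2 - (s ^+ 2)%:P) = 3%N by rewrite size_XnsubC.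
rewrite -ltnS -size_minPoly -sz; apply: dvdp_leq.
  by rewrite -size_poly_eq0 sz.
apply: minPoly_dvdp; first by rewrite rpredB ?rpredX ?polyOverX ?polyOverC.
by rewrite /root !hornerE subrr.
Qed.

Lemma sqr_eq_mem (F : fieldType) (L : fieldExtType F) (U : {subfield L})
    (s t : L) : s ^+ 2 = t ^+ 2 -> t \in U -> s \in U.
Proof.
by move/eqP; rewrite eqf_sqr => /orP[] /eqP -> //; rewrite rpredN.
Qed.

(** If v = f0 + f1 alpha with f0, f1 rational, then f1 = 0 makes v rational, while f1 != 0 allows
    solving for alpha, which puts alpha, hence all of [L], inside [U]. *)
Lemma primitive_deg_gt1 (L : fieldExtType rat) (U : {subfield L})
    (alpha v : L) :
  U != {:L}%VS :> {vspace L} -> v \in U -> v \notin 1%VS ->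
  primitive_element alpha -> (1 < deg_at alpha v)%N.
Proof.
move=> UnL vU v1 pa; rewrite /deg_at ltnNge; apply/negP => szf.
set f := Fadjoin_poly 1 alpha v in szf.
have fv : f.[alpha] = v by rewrite Fadjoin_poly_eq // pa memvf.
have /polyOverP f1 : f \is a polyOver 1%VS := Fadjoin_polyOver 1%AS alpha v.
have szf2 : (size f <= 2)%N by case: (size f) szf.
move: fv; rewrite (horner_coef_wide _ szf2) !big_ord_recl big_ord0 /=.
rewrite expr0 mulr1 addr0 /bump /= expr1 => fv.
have [f0|fn0] := eqVneq f`_1 0.
  by case/negP: v1; rewrite -fv f0 mul0r addr0; apply: f1.
have fU i : f`_i \in U by apply: (subvP (sub1v U)); apply: f1.
have aU : alpha \in U.
  have -> : alpha = (v - f`_0) / f`_1.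
    by rewrite -fv [_ + _ * _]addrC addrK mulrAC mulfV // mul1r.
  by rewrite rpred_div ?rpredB ?fU.
case/negP: UnL; rewrite eqEsubv subvf /= -pa.
by apply/FadjoinP; split=> //; apply: sub1v.
Qed.

Theorem theorem5p8 (A B C : int) (L : fieldExtType rat) (sA sB sC : L)
    (a b : rat)
    (ABC_uniq : uniq [:: A; B; C; A * B * C])
    (A_neq0 : A != 0) (B_neq0 : B != 0) (C_neq0 : C != 0)
    (A_sqf : square_free A) (B_sqf : square_free B) (C_sqf : square_free C)
    (ABC_sqf : square_free (A * B * C))
    (sA2 : sA ^+ 2 = A%:~R) (sB2 : sB ^+ 2 = B%:~R) (sC2 : sC ^+ 2 = C%:~R)
    (L_gen : <<1 & [:: sA; sB; sC]>>%VS = {:L}%VS)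
    (L_triquadratic : \dim {:L} = 8%N)
    (a_neq0 : a != 0) (b_neq0 : b != 0)
    (ab_eq : a ^+ 2 - 1 = (B - A)%:~R * b ^+ 2)
    (B_neq_a : B%:~R != a) :
  min_deg_is (sA + a *: sB) 2.
Proof.
have algZ (U : {subfield L}) (q : rat) : q%:A \in U by rewrite rpredZ ?rpred1.
have intU (U : {subfield L}) (n : int) : n%:~R \in U by rewrite rpred_int.
pose K1 := <<1; sA>>%AS; pose K2 := <<K1; sB>>%AS.
have genL : <<K2; sC>>%VS = {:L}%VS.
  by rewrite -L_gen !adjoin_cons adjoin_nil subfield_closed.
have dK1 : (\dim K1 <= 2)%N.
  by have := @dim_Fadjoin_sqr _ _ 1%AS sA; rewrite sA2 intU dimv1 => ->.
have dK2 : (\dim K2 <= \dim K1 * 2)%N by apply: dim_Fadjoin_sqr; rewrite sB2.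
have dL : (8 <= \dim K2 * 2)%N.
  by rewrite -L_triquadratic -genL; apply: dim_Fadjoin_sqr; rewrite sC2.
have sAK1 : sA \in K1 by apply: memv_adjoin.
(* Otherwise [K2] = [K1] has dimension at most 2, and adjoining [sC] gives at most 4 < 8. The
   irrationality of v and the nonvanishing of [c], [x] and A - a^2 B all come down to this fact. *)
have sBK1 : sB \notin K1.
  apply/negP => /Fadjoin_idP E; move: dL; rewrite /= E leqNgt.
  by rewrite (leq_ltn_trans (leq_mul dK1 (leqnn 2))).
have K2nL : K2 != {:L}%VS :> {vspace L}.
  apply/eqP => E; move: (leq_trans dK2 (leq_mul dK1 (leqnn 2))).
  by rewrite E L_triquadratic.
pose a' : L := a%:A; pose b' : L := b%:A.
have an0 : a' != 0 by rewrite scaler_eq0 negb_or a_neq0 oner_eq0.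
have Cn0 : C%:~R != 0 :> L.
  by rewrite -(rmorph_int (in_alg L)) fmorph_eq0 intr_eq0.
have n2 : 2 != 0 :> L by rewrite -(rmorph_nat (in_alg L)) fmorph_eq0.
have scE (q : rat) (z : L) : q *: z = q%:A * z by rewrite mulr_algl.
rewrite scE -/a'; set v := sA + a' * sB.
have vK2 : v \in K2.
  by rewrite rpredD ?rpredM ?algZ ?memv_adjoin // (subvP (subv_adjoin _ _)).
have v1 : v \notin 1%VS.
  apply: contra sBK1 => v1; have -> : sB = (v - sA) / a' by rewrite /v; field.
  by rewrite rpred_div ?algZ ?rpredB // (subvP (sub1v _)).
(* Here and in [c'E], [r'E], the integers A and B become squares of [sA] and [sB], so that the later
   identities are polynomial in [sA], [sB], [a'], [b']. *)
have ab' : a' ^+ 2 - 1 = (sB ^+ 2 - sA ^+ 2) * b' ^+ 2.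
  have := congr1 (in_alg L) ab_eq.
  by rewrite rmorphM rmorphB !rmorphXn rmorph1 rmorph_int intrB -sA2 -sB2.
pose c : rat := 2 * b * (a ^+ 2 - B%:~R * b ^+ 2).
pose r : rat := a ^+ 2 + a ^+ 2 * b ^+ 2 * A%:~R + b ^+ 2 * B%:~R
                + b ^+ 4 * A%:~R * B%:~R.
pose x : L := a' + a' * b' * sA + b' * sB - b' ^+ 2 * sA * sB.
have c'E : c%:A = 2 * b' * (a' ^+ 2 - sB ^+ 2 * b' ^+ 2) :> L.
  have -> : c%:A = in_alg L c by [].
  by rewrite /c !(rmorphM, rmorphB, rmorphXn, rmorph_int, rmorph_nat) -sB2.
have r'E : r%:A = a' ^+ 2 + a' ^+ 2 * b' ^+ 2 * sA ^+ 2 + b' ^+ 2 * sB ^+ 2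
                + b' ^+ 4 * sA ^+ 2 * sB ^+ 2 :> L.
  have -> : r%:A = in_alg L r by [].
  by rewrite /r !(rmorphM, rmorphD, rmorphXn, rmorph_int) -sA2 -sB2.
(* If c = 0 then B = (a/b)^2, so [sB] would be rational. *)
have cn0 : c != 0.
  rewrite !mulf_neq0 // subr_eq0; apply: contra sBK1 => /eqP E.
  apply: (@sqr_eq_mem _ _ _ _ (a / b)%:A); last exact: algZ.
  rewrite sB2 -(rmorph_int (in_alg L)) -[RHS](rmorphXn (in_alg L)).
  by congr (in_alg L _); rewrite exprMn E exprVn mulfK ?expf_neq0.
have c'n0 : c%:A != 0 :> L by rewrite scaler_eq0 negb_or cn0 oner_eq0.
have xE : x ^+ 2 = r%:A + c%:A * v.
  rewrite r'E c'E /x /v.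
  have ab2 : a' ^+ 2 = 1 + (sB ^+ 2 - sA ^+ 2) * b' ^+ 2.
    by rewrite -ab' addrC subrK.
  (* The [sA] coefficient of x^2 is c identically. The [sB] coefficient is 2ab(1 - A b^2), and it
     equals c a because the hypothesis says a^2 - B b^2 = 1 - A b^2. *)
  have -> : 2 * b' * (a' ^+ 2 - sB ^+ 2 * b' ^+ 2) * (sA + a' * sB) =
    2 * b' * (a' ^+ 2 - sB ^+ 2 * b' ^+ 2) * sA +
    2 * b' * (1 - sA ^+ 2 * b' ^+ 2) * a' * sB by rewrite ab2; ring.
  by ring.
(* If x = 0, then r + c v = 0 would make v rational. *)
have xn0 : x != 0.
  apply: contra v1 => /eqP x0; have -> : v = - r%:A / c%:A.
    by apply: (mulfI c'n0); rewrite mulrCA mulfV // mulr1; apply/eqP;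
       rewrite -addr_eq0 addrC -xE x0 expr0n.
  by rewrite rpred_div ?rpredN ?(algZ 1%AS).
pose alpha := x * sC.
have alphaE : alpha ^+ 2 = C%:~R * (r%:A + c%:A * v).
  by rewrite exprMn xE sC2 mulrC.
have vE : v = alpha ^+ 2 / (C%:~R * c%:A) - r%:A / c%:A.
  by rewrite alphaE; field; rewrite Cn0 c'n0.
have sCD : sC = alpha / x by rewrite /alpha mulrAC mulfV // mul1r.
clearbody alpha.
have palpha : primitive_element alpha.
  pose E := <<1; alpha>>%AS.
  have alE : alpha \in E by apply: memv_adjoin.
  have vE' : v \in E.
    by rewrite vE rpredB ?rpred_div ?rpredM ?rpredX ?intU ?algZ.
  (* The cross term of v^2 is 2 a sA sB; the other terms are rational. *)
  have sABE : sA * sB \in E.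
    have -> : sA * sB = (v ^+ 2 - A%:~R - a' ^+ 2 * B%:~R) / (2 * a').
      by rewrite -sA2 -sB2 /v; field; rewrite an0 n2.
    by rewrite rpred_div ?rpredB ?rpredM ?rpredX ?rpred_nat ?intU ?algZ.
  have dn0 : sA ^+ 2 - a' ^+ 2 * sB ^+ 2 != 0.
    rewrite subr_eq0; apply: contra sBK1 => /eqP dE.
    apply: (@sqr_eq_mem _ _ _ _ (sA / a')); last by rewrite rpred_div ?algZ.
    by rewrite exprMn dE exprVn mulrAC mulfV ?expf_neq0 ?mul1r.
  (* Since sA sB v = A sB + a B sA, subtracting a B v eliminates [sA] and leaves (A - a^2 B) sB. *)
  have sBE : sB \in E.
    have -> : sB = (sA * sB * v - a' * B%:~R * v) / (A%:~R - a' ^+ 2 * B%:~R).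
      by rewrite -sA2 -sB2 /v; field; have := dn0; rewrite -exprMn.
    have sABvE : sA * sB * v \in E by rewrite rpredM.
    by rewrite rpred_div ?rpredB // ?rpredM ?rpredX ?intU ?algZ.
  have sAE : sA \in E.
    have -> : sA = v - a' * sB by rewrite /v addrK.
    by rewrite rpredB ?rpredM ?algZ.
  have xEE : x \in E by rewrite !(rpredB, rpredD, rpredM, rpredX) ?algZ.
  have sCE : sC \in E by rewrite sCD rpred_div.
  apply/eqP; rewrite eqEsubv subvf /= -genL.
  apply/FadjoinP; split=> //; apply/FadjoinP; split=> //.
  by apply/FadjoinP; split=> //; apply: sub1v.
(* The lower bound holds because v is irrational and lies in the proper subfield [K2]. *)
split; last by move=> beta; apply: primitive_deg_gt1 K2nL vK2 v1.
exists alpha => //.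
(* These are the coefficients in [vE], read as v = p alpha^2 + q. Size 3 is degree 2, and 3 <= 8
   makes this the reduced polynomial of v. *)
pose p : rat := (C%:~R * c)^-1; pose q : rat := - (r / c).
have pn0 : p != 0 by rewrite invr_eq0 mulf_neq0 ?intr_eq0.
have szf : size (p *: 'X^2 + q%:P) = 3%N.
  rewrite size_polyDl size_scale // size_polyXn //.
  by rewrite (leq_ltn_trans (size_polyC_leq1 q)).
rewrite (@deg_atE _ _ _ (p *: 'X^2 + q%:P)) ?szf ?L_triquadratic //.
rewrite rmorphD /= map_polyC /= map_polyZ /= map_polyXn !hornerE /= vE.
have -> : p%:A = (C%:~R * c%:A)^-1 :> L.
  have -> : p%:A = in_alg L p by [].
  by rewrite fmorphV rmorphM rmorph_int.
have -> : q%:A = - (r%:A / c%:A) :> L.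
  have -> : q%:A = in_alg L q by [].
  by rewrite rmorphN fmorph_div.
by rewrite -mulrA mulrC -expr2.
Qed.
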